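(* Let $\Lambda\subset\mathbb{C}$ be a regular self-similar arc generated by a basic figure with vertices $z_0,\dots,z_\ell$. Suppose that $1\le p\le\ell-1$ and that the corner angle $\theta_p>0$. Then $\Lambda$ satisfies Condition $Q_p^t$ for every $t\ge1$.
   Context: Identify $\mathbb{R}^2$ with $\mathbb{C}$. Basic figures. Let $\Omega$ be a polygon formed by a sequence of successive segments in the plane, with $\ell+1$ vertices $z_0,z_1,\dots,z_\ell$, such that $z_1,z_{\ell-1}$ lie on the segment $\overline{z_0z_\ell}$ and $z_{\ell-1}$ lies on the segment $\overline{z_1z_\ell}$. Suppose there is a vertex $z_q$ such that all vertices belong to $\Pi=\{z_q\}\cup\overline{z_0z_\ell}\cup\Pi_0$, where $\Pi_0$ is the interior of the triangle $z_0z_\ell z_q$; let $\Pi_1$ be the closure of $\Pi_0$. For $j=1,\dots,\ell$ let $S_j$ be the unique orientation-preserving similitude (of the form $z\mapsto az+b$) with $S_j(z_0)=z_{j-1}$, $S_j(z_\ell)=z_j$. $\Omega$ is a basic figure if moreover: the $S_j$ are contractive; the sets $S_j(\Pi_0)$ are pairwise disjoint; $S_j(z_q)\in\Pi_1$ for all $j$; and $S_j(\Pi_1)\cap(\overline{z_qz_0}\cup\overline{z_qz_\ell})=\emptyset$ for $j\notin\{1,\ell,q,q+1\}$. Standing assumption: $\operatorname{Im}\frac{z_q-z_0}{z_\ell-z_0}>0$. Angles (all arguments in $[0,2\pi)$). Corner angle at $z_p$, $1\le p\le\ell-1$: $\theta_p=\arg\frac{S_p(z_q)-z_p}{S_{p+1}(z_q)-z_p}$.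 Put $\theta_{\min}=\min_p\theta_p$, $\eta_1=\arg\frac{S_q(z_q)-z_q}{z_0-z_q}$, $\eta_2=\arg\frac{z_\ell-z_q}{S_{q+1}(z_q)-z_q}$, $\eta_0=\min(\eta_1,\eta_2)$. The characteristic angle is $\xi=\theta_{\min}+\eta_0$. Regular self-similar arcs. Let $\Lambda$ be the unique nonempty compact set with $\Lambda=\bigcup_{j=1}^\ell S_j(\Lambda)$. If $\Lambda$ is an arc (homeomorphic to $[0,1]$), it is called the self-similar arc generated by $\Omega$; it is ordered ($\prec$, $\preceq$) from $z_0$ to $z_\ell$, and $S_j(\Lambda)$ is its subarc from $z_{j-1}$ to $z_j$. A regular self-similar arc is a self-similar arc generated by a basic figure with positive characteristic angle. $|\Lambda(x,y)|$ is the diameter of the subarc of $\Lambda$ between $x$ and $y$. $\Lambda$ satisfies Condition $Q_p^t$ if there is a constant $C_p>0$ such that $|\Lambda(x,y)|^t\le C_p|x-y|$ whenever $x,y\in\Lambda$ and $z_{p-1}\preceq x\preceq z_p\preceq y\preceq z_{p+1}$. *)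

(* Defs.v *)
From HB Require Import structures.
From mathcomp Require Import all_boot all_order all_algebra.
From mathcomp Require Import all_classical all_reals all_analysis.
From mathcomp Require Export complex.
From mathcomp Require Import ring lra.

Set Implicit Arguments.
Unset Strict Implicit.
Unset Printing Implicit Defensive.

Import Order.TTheory GRing.Theory Num.Theory.
Import numFieldNormedType.Exports.

Local Open Scope classical_set_scope.
Local Open Scope ring_scope.
Local Open Scope complex_scope.

(* real-closed gives R[i] no topology; this is the one of its norm. *)
HB.instance Definition _ (R : realType) := NormedModule.copy R[i] (R[i]^o).

Section Plane.
Context {R : realType}.
Implicit Types (a b c w : R[i]) (A B : set R[i]).

(* On R[i] the library norm `|w| is R[i]-valued; this is its real value. *)
Definition cmod w : R := complex.Re `|w|.

(* The argument in [0, 2 pi), unspecified at 0. *)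
Definition arg w : R :=
  get [set t : R | 0 <= t < 2 * pi /\
                   w = (cmod w * cos t) +i* (cmod w * sin t)].

Definition closed_segment a b : set R[i] :=
  [set w | exists2 s : R, 0 <= s <= 1 & w = a + s%:C * (b - a)].

Definition triangle a b c : set R[i] :=
  [set w | exists r s t : R,
     [/\ 0 <= r, 0 <= s, 0 <= t, r + s + t = 1
       & w = r%:C * a + s%:C * b + t%:C * c]].

Definition contractive (f : R[i] -> R[i]) : Prop :=
  exists2 k : R, k < 1 & forall a b, cmod (f a - f b) <= k * cmod (a - b).

Definition diam A : R :=
  sup [set d | exists a b, [/\ A a, A b & d = cmod (a - b)]].

Definition homeomorphism_unit_interval (g : R -> R[i]) A : Prop :=
  [/\ {within `[0, 1], continuous g},
      g @` `[0, 1] = A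
    & exists2 h : R[i] -> R, {within A, continuous h}
        & forall s, 0 <= s <= 1 -> h (g s) = s].

Definition is_arc A : Prop := exists g, homeomorphism_unit_interval g A.

(* The order of the arc A from its end a to its end b: the order of the
   parameters, which is the same for all homeomorphisms sending 0 to a and
   1 to b. *)
Definition arc_le A a b (x y : R[i]) : Prop :=
  exists g, [/\ homeomorphism_unit_interval g A, g 0 = a, g 1 = b
    & exists s t, [/\ 0 <= s, s <= t, t <= 1, g s = x & g t = y]].

Definition subarc A a b (x y : R[i]) : set R[i] :=
  [set w | arc_le A a b x w /\ arc_le A a b w y \/
           arc_le A a b y w /\ arc_le A a b w x].

End Plane.

(* The vertices are z 0, ..., z l; the values of z beyond l play no role.
   The apex is z q. *)
Section Figure.
Context {R : realType} (l : nat) (z : nat -> R[i]) (q : nat).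

Definition base := closed_segment (z 0) (z l).

(* Pi_0, Pi_1 and Pi. *)
Definition open_triangle : set R[i] := (triangle (z 0) (z l) (z q))°.
Definition full_triangle : set R[i] := closure open_triangle.
Definition vertex_region : set R[i] := [set z q] `|` base `|` open_triangle.

(* The map w |-> a w + b with z 0 |-> z j.-1 and z l |-> z j,
   see similitude_ends and similitude_unique. *)
Definition similitude (j : nat) (w : R[i]) : R[i] :=
  z j.-1 + (z j - z j.-1) / (z l - z 0) * (w - z 0).

(* The successive segments are nondegenerate, and two consecutive ones meet
   only at their common vertex, so the line does not fold back on itself.
   Segments that are not consecutive are not constrained here. *)
Definition polygon : Prop :=
  (forall j, (1 <= j <= l)%N -> z j.-1 != z j) /\
  (forall p, (1 <= p <= l.-1)%N ->
     closed_segment (z p.-1) (z p) `&` closed_segment (z p) (z p.+1)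
     = [set z p]).

Record basic_figure : Prop := BasicFigure {
  bf_polygon : polygon ;
  bf_first_on_base : base (z 1) ;
  bf_last_on_base : base (z l.-1) ;
  bf_last_after_first : closed_segment (z 1) (z l) (z l.-1) ;
  bf_apex : (q <= l)%N ;
  bf_vertices : forall j, (j <= l)%N -> vertex_region (z j) ;
  bf_contractive : forall j, (1 <= j <= l)%N -> contractive (similitude j) ;
  bf_disjoint : trivIset [set j | (1 <= j <= l)%N]
                         (fun j => similitude j @` open_triangle) ;
  bf_apex_image : forall j, (1 <= j <= l)%N ->
    full_triangle (similitude j (z q)) ;
  bf_avoid_sides : forall j, (1 <= j <= l)%N -> j \notin [:: 1; l; q; q.+1]%N ->
    similitude j @` full_triangle `&`
      (closed_segment (z q) (z 0) `|` closed_segment (z q) (z l)) = set0 ;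
  bf_orientation : 0 < complex.Im ((z q - z 0) / (z l - z 0)) }.

Definition corner_angle (p : nat) : R :=
  arg ((similitude p (z q) - z p) / (similitude p.+1 (z q) - z p)).

(* The minimum over 1 <= p <= l.-1; a basic figure has 1 <= l.-1, so the
   default value is one of the angles of the range. *)
Definition min_corner_angle : R :=
  \big[Num.min/corner_angle 1]_(1 <= p < l) corner_angle p.

Definition apex_angle1 : R := arg ((similitude q (z q) - z q) / (z 0 - z q)).
Definition apex_angle2 : R := arg ((z l - z q) / (similitude q.+1 (z q) - z q)).

Definition characteristic_angle : R :=
  min_corner_angle + Num.min apex_angle1 apex_angle2.

Definition self_similar_set (L : set R[i]) : Prop :=
  [/\ compact L, L !=set0
    & L = \bigcup_(j in [set j | (1 <= j <= l)%N]) similitude j @` L].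

Definition regular_self_similar_arc (L : set R[i]) : Prop :=
  [/\ basic_figure, 0 < characteristic_angle, self_similar_set L & is_arc L].

Definition condition_Q (L : set R[i]) (p : nat) (t : R) : Prop :=
  let le := arc_le L (z 0) (z l) in
  exists2 C : R, 0 < C & forall x y : R[i], L x -> L y ->
    le (z p.-1) x -> le x (z p) -> le (z p) y -> le y (z p.+1) ->
    diam (subarc L (z 0) (z l) x y) `^ t <= C * cmod (x - y).

End Figure.

Section Facts.
Context {R : realType}.

Lemma similitude_ends (l : nat) (z : nat -> R[i]) (j : nat) : z 0 != z l ->
  similitude l z j (z 0) = z j.-1 /\ similitude l z j (z l) = z j.
Proof.
move=> z0l; have nz : z l - z 0 != 0 by rewrite subr_eq0 eq_sym.
split; first by rewrite /similitude subrr mulr0 addr0.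
by rewrite /similitude divfK // addrC subrK.
Qed.

Lemma similitude_unique (l : nat) (z : nat -> R[i]) (j : nat) (a b : R[i]) :
  z 0 != z l -> a * z 0 + b = z j.-1 -> a * z l + b = z j ->
  forall w, similitude l z j w = a * w + b.
Proof.
move=> z0l e0 el w; have nz : z l - z 0 != 0 by rewrite subr_eq0 eq_sym.
rewrite /similitude -e0 -el.
have -> : a * z l + b - (a * z 0 + b) = a * (z l - z 0) by ring.
by rewrite mulfK //; ring.
Qed.

Lemma cmodE (w : R[i]) :
  cmod w = Num.sqrt (complex.Re w ^+ 2 + complex.Im w ^+ 2).
Proof. by rewrite /cmod normc_def. Qed.

Lemma arg_spec (w : R[i]) : w != 0 ->
  0 <= arg w < 2 * pi /\ w = (cmod w * cos (arg w)) +i* (cmod w * sin (arg w)).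
Proof.
move=> w0.
rewrite /arg; set P := (X in get X).
suff : exists t, P t by exact: xgetPex.
rewrite {}/P /=.
case: w w0 => x y; rewrite cmodE /= => w0.
set m := Num.sqrt _; have sq_ge0 : 0 <= x ^+ 2 + y ^+ 2.
  by rewrite addr_ge0 ?sqr_ge0.
have sq_gt0 : 0 < x ^+ 2 + y ^+ 2.
  rewrite lt_neqAle sq_ge0 andbT eq_sym paddr_eq0 ?sqr_ge0 // !sqrf_eq0.
  by move: w0; rewrite eq_complex.
have m_gt0 : 0 < m by rewrite sqrtr_gt0.
have m2 : m ^+ 2 = x ^+ 2 + y ^+ 2 by rewrite sqr_sqrtr.
have m0 : m != 0 by rewrite gt_eqF.
have sqE : 1 - (x / m) ^+ 2 = (y / m) ^+ 2.
  by rewrite !expr_div_n; apply/eqP; rewrite subr_eq -mulrDl addrC -m2 divff ?sqrf_eq0.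
have rng : -1 <= x / m <= 1.
  by rewrite -ler_norml -(expr_le1 (n := 2)) // real_normK ?num_real //
    -subr_ge0 sqE sqr_ge0.
have Ec : m * cos (acos (x / m)) = x by rewrite acosK ?in_itv //= mulrC divfK.
have Es : m * sin (acos (x / m)) = `|y|.
  by rewrite sin_acos // sqE sqrtr_sqr normrM normfV (gtr0_norm m_gt0) mulrC divfK.
have pi0 := @pi_gt0 R; have ge0 := acos_ge0 rng; have lepi := acos_lepi rng.
case: (lerP 0 y) => y0.
  exists (acos (x / m)); split; first by apply/andP; split => //; lra.
  by rewrite Ec Es ger0_norm.
have pos : 0 < acos (x / m).
  rewrite acos_gt0 //; case/andP: rng => -> /=; rewrite lt_neqAle => ->.
  rewrite andbT; apply/eqP => e; move: sqE; rewrite e expr1n subrr => /esym/eqP.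
  by rewrite sqrf_eq0 mulf_eq0 invr_eq0 (negbTE m0) orbF lt_eqF.
exists (2 * pi - acos (x / m)); split; first by apply/andP; split; lra.
have -> : 2 * pi - acos (x / m) = - acos (x / m) + pi *+ 2 :> R.
  by rewrite mulr_natl addrC.
by rewrite cosD2pi sinD2pi cosN sinN mulrN Ec Es ltr0_norm // opprK.
Qed.

End Facts.

(* Main.v *)
Require Import Defs.
From mathcomp Require Import all_boot all_order all_algebra.
From mathcomp Require Import all_classical all_reals all_analysis.
From mathcomp Require Import ring lra.

Set Implicit Arguments.
Unset Strict Implicit.
Unset Printing Implicit Defensive.

Import Order.TTheory GRing.Theory Num.Theory.
Import numFieldNormedType.Exports.

Local Open Scope classical_set_scope.
Local Open Scope ring_scope.
Local Open Scope complex_scope.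

(* The two pieces S_p(L) and S_(p+1)(L) lie in two sectors with apex z_p.  The
   sectors have disjoint interiors because the images of the open triangle are
   disjoint; they share no boundary ray because theta_p > 0 on one side and
   because the polygon does not fold back at z_p on the other.  Hence they meet
   only at z_p, so |x - y| >= c (|x - z_p| + |y - z_p|) for x, y in the two
   pieces.  On the other hand, near an end e of L the arc is invariant under a
   similarity fixing e, so that the subarc from x to e has diameter at most
   K |x - e|, and S_p, S_(p+1) carry this estimate to z_p.  This is the case
   t = 1; larger t follow because L is bounded. *)

(** * The real-valued modulus and the topology it induces *)

Section Modulus.
Context {R : realType}.
Implicit Types a b c w x y : R[i].

Lemma norm_cmod a : `|a| = (cmod a)%:C.
Proof. by rewrite /cmod normc_def. Qed.

Lemma cmod_ge0 a : 0 <= cmod a.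
Proof. by rewrite cmodE sqrtr_ge0. Qed.

Lemma cmodM a b : cmod (a * b) = cmod a * cmod b.
Proof. by apply: complexI; rewrite rmorphM /= -!norm_cmod normrM. Qed.

Lemma cmodD a b : cmod (a + b) <= cmod a + cmod b.
Proof. by rewrite -lecR rmorphD /= -!norm_cmod ler_normD. Qed.

Lemma cmodN a : cmod (- a) = cmod a.
Proof. by apply: complexI; rewrite -!norm_cmod normrN. Qed.

Lemma cmodB a b : cmod (a - b) = cmod (b - a).
Proof. by rewrite -cmodN opprB. Qed.


Lemma cmod_eq0 a : (cmod a == 0) = (a == 0).
Proof. by rewrite -[RHS]normr_eq0 norm_cmod -(inj_eq (@complexI R)). Qed.

Lemma cmod0 : cmod (0 : R[i]) = 0.
Proof. by apply/eqP; rewrite cmod_eq0. Qed.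

Lemma cmod_gt0 a : (0 < cmod a) = (a != 0).
Proof. by rewrite lt_def cmod_ge0 cmod_eq0 andbT. Qed.

Lemma cmod_real (t : R) : cmod t%:C = `|t|.
Proof. by rewrite cmodE /= expr0n addr0 sqrtr_sqr. Qed.

Lemma Re_le_cmod a : `|complex.Re a| <= cmod a.
Proof. by rewrite -lecR -norm_cmod normc_ge_Re. Qed.

Lemma Im_le_cmod a : `|complex.Im a| <= cmod a.
Proof.
by rewrite cmodE -sqrtr_sqr ler_wsqrtr // lerDr sqr_ge0.
Qed.

(** Balls of [R[i]] have radii in [R[i]]. A positive element of [R[i]] has zero imaginary part, so
    real radii suffice. *)
Lemma nbhs_cmod x (U : set R[i]) :
  nbhs x U <-> exists2 e : R, 0 < e & forall y, cmod (x - y) < e -> U y.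
Proof.
split.
  move=> /nbhs_ballP[e /= e0 eU].
  have er : e = (complex.Re e)%:C.
    by move: e0; rewrite ltcE /=; case: (e) => ? ? /= /andP[/eqP -> _].
  exists (complex.Re e); first by move: e0; rewrite er ltcR.
  by move=> y xy; apply: eU; rewrite /ball /= /ball_ er norm_cmod ltcR.
case=> e e0 eU; apply/nbhs_ballP; exists e%:C; first by rewrite /= ltcR.
by move=> y; rewrite /ball /= norm_cmod ltcR => /eU.
Qed.

Lemma cmod_continuous : continuous (fun a : R[i] => cmod a : R).
Proof.
move=> x U /nbhs_ballP[e /= e0 eU]; apply/nbhs_cmod; exists e => // y xy.
apply: eU; apply: le_lt_trans xy; rewrite ler_norml; apply/andP; split.
  by have := cmodD x (y - x); rewrite addrC subrK cmodB; lra.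
by have := cmodD y (x - y); rewrite addrC subrK; lra.
Qed.

End Modulus.

(** * Two plane cones that meet only at their apex *)

Section Cones.
Context {R : realType}.
Implicit Types (w a b A B : R[i]).

(** Strict inequalities survive a small step. This is used to push a boundary point common to two
    cones into both open cones. *)
Lemma gt0_perturb (x y z dx dy dz : R) : 0 < x -> 0 < y -> 0 < z ->
  exists2 e : R, 0 < e & [/\ 0 < x + e * dx, 0 < y + e * dy & 0 < z + e * dz].
Proof.
move=> x0 y0 z0.
have aux : forall u d : R, 0 < u -> exists2 e : R, 0 < e &
    forall e', 0 <= e' <= e -> 0 < u + e' * d.
  move=> u d u0; have d0 : 0 < `|d| + 1 by rewrite ltr_wpDl.
  exists (u / (2 * (`|d| + 1))) => [|e /andP[e0]].
    by rewrite divr_gt0 // mulr_gt0.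
  rewrite ler_pdivlMr ?mulr_gt0 // => h.
  have : e * - d <= e * `|d| by rewrite ler_wpM2l // -normrN ler_norm.
  by lra.
have [e e0 he] := aux x dx x0; have [f f0 hf] := aux y dy y0.
have [g g0 hg] := aux z dz z0; pose m := Num.min e (Num.min f g).
have m0 : 0 < m by rewrite !lt_min e0 f0.
have /and3P[me mf mg] : [&& m <= e, m <= f & m <= g] by rewrite !ge_min !lexx !orbT.
by exists m => //; split; [apply: he|apply: hf|apply: hg]; rewrite (ltW m0).
Qed.

(* The columns (P, r) and (Q, T) are the coordinates in the basis (1, w) of
   the generators k and k (1 - w) of the first cone, where k = p + r w,
   w ^ 2 = 2 u w - n, P = p, Q = p + r n and T = r - p - 2 u r. *)
Lemma cones_meet_coord (p r n u s t : R) : u ^+ 2 < n -> p != 0 \/ r != 0 ->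
  ~ (r = 0 /\ 0 < p) ->
  ~ (p + r * n = 0 /\ 0 < r - p - 2 * u * r) ->
  (forall s t : R, 0 < s -> 0 < t -> 0 < p * s + (p + r * n) * t ->
     0 < r * s + (r - p - 2 * u * r) * t -> False) ->
  0 <= s -> 0 <= t -> 0 <= p * s + (p + r * n) * t ->
  0 <= r * s + (r - p - 2 * u * r) * t -> s = 0 /\ t = 0.
Proof.
move=> un pr0; set Q := p + r * n; set T := r - p - 2 * u * r.
(* The determinant equals -|k|^2, because n = |w|^2 and u = Re w; the bound u^2 < n says that w is
   not real. *)
have det : p * T - Q * r < 0.
  have -> : p * T - Q * r = - ((p + u * r) ^+ 2 + r ^+ 2 * (n - u ^+ 2)).
    by rewrite /T /Q; ring.
  rewrite oppr_lt0; case: (eqVneq r 0) pr0 => [-> | r0 _].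
    by rewrite mulr0 addr0 expr0n mul0r addr0 => -[] // p0; rewrite exprn_even_gt0.
  by rewrite ltr_wpDl ?sqr_ge0 // mulr_gt0 ?subr_gt0 // exprn_even_gt0.
move=> hi hii hiii s0 t0 h1 h2.
have sq_gt0 (a b : R) : a != 0 \/ b != 0 -> 0 < a ^+ 2 + b ^+ 2.
  by case=> h; [apply: ltr_pwDl|apply: ltr_wpDl]; rewrite ?sqr_ge0 // exprn_even_gt0.
case: (ltrgtP s 0) s0 => // [s0 _|s0 _]; case: (ltrgtP t 0) t0 => // t0 _.
- exfalso; case: (ltrgtP (p * s + Q * t) 0) h1 => // [h1|h1] _;
    case: (ltrgtP (r * s + T * t) 0) h2 => // [h2|h2] _.
  + exact: (hiii s t).
  (* The second coordinate vanishes. A small step along its gradient (r, T) makes it positive and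
     keeps the first one positive. The next case is symmetric, with gradient (p, Q). *)
  + have [e e0 [H1 H2 H3]] := gt0_perturb r T (p * r + Q * T) s0 t0 h1.
    apply: (hiii (s + e * r) (t + e * T)) => //; first by move: H3; lra.
    have /(mulr_gt0 e0) : 0 < r ^+ 2 + T ^+ 2.
      apply: sq_gt0; apply/orP; rewrite -negb_and.
      by apply/negP => /andP[/eqP r0 /eqP T0]; move: det; rewrite r0 T0; lra.
    by move: h2; lra.
  + have [e e0 [H1 H2 H3]] := gt0_perturb p Q (r * p + T * Q) s0 t0 h2.
    apply: (hiii (s + e * p) (t + e * Q)) => //; last by move: H3; lra.
    have /(mulr_gt0 e0) : 0 < p ^+ 2 + Q ^+ 2.
      apply: sq_gt0; apply/orP; rewrite -negb_and.
      by apply/negP => /andP[/eqP r0 /eqP T0]; move: det; rewrite r0 T0; lra.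
    by move: h1; lra.
  + have : (p * T - Q * r) * s = 0.
      have -> : (p * T - Q * r) * s = (p * s + Q * t) * T - (r * s + T * t) * Q by ring.
      by rewrite h1 h2; ring.
    by move/eqP; rewrite mulf_eq0 lt_eqF // gt_eqF.
(* The common point is on the ray of the first generator. The excluded common ray gives r > 0, and
   adding a little of the second generator leads into both open cones. *)
- exfalso; move: h1 h2; rewrite t0 !mulr0 !addr0 !pmulr_lge0 // => p0 r0.
  have {}r0 : 0 < r.
    rewrite lt_def r0 andbT; apply/eqP => r00; apply: hi; split=> //.
    by case: pr0 => [p00|/eqP //]; rewrite lt_def p0 andbT.
  have n0 : 0 < n by rewrite (le_lt_trans _ un) ?sqr_ge0.
  have Q0 : 0 < Q by rewrite /Q ltr_wpDl ?mulr_gt0.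
  have [e e0 [H1 _ _]] := gt0_perturb T 0 0 r0 r0 r0.
  apply: (hiii 1 e) => //; rewrite ?mulr1; last by rewrite mulrC in H1; lra.
  by rewrite ltr_wpDl ?mulr_gt0.
(* The common point is on the ray of the second generator. The other excluded ray and the
   determinant give Q > 0; if T = 0, the determinant also gives r > 0. Adding a little of the first
   generator then leads into both open cones. *)
- exfalso; move: h1 h2; rewrite s0 !mulr0 !add0r !pmulr_lge0 // => Q0 T0.
  have {}Q0 : 0 < Q.
    rewrite lt_def Q0 andbT; apply/eqP => Q00; apply: hii; split=> //.
    rewrite lt_def T0 andbT; apply/eqP => T00.
    by move: det; rewrite Q00 T00; lra.
  case: (ltrgtP T 0) T0 => // [T0|T0] _.
    have [e e0 [H1 H2 _]] := gt0_perturb p r 0 Q0 T0 T0.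
    by apply: (hiii e 1) => //; rewrite mulr1 addrC [X in _ + X]mulrC.
  have r0 : 0 < r by move: det; rewrite T0 mulr0 sub0r oppr_lt0 pmulr_rgt0.
  have [e e0 [H1 _ _]] := gt0_perturb p 0 0 Q0 Q0 Q0.
  apply: (hiii e 1) => //; rewrite ?mulr1 ?T0 ?addr0 ?mulr_gt0 //.
  by rewrite addrC mulrC.
Qed.

(** Division by [B] reduces to [cones_meet_coord] in the real basis (1, w). Only two pairs of
    boundary rays have to be compared: since Im w > 0, a coincidence of [A] with [B * w], or of
    [A * (1 - w)] with [B], would put both cones on the same side of the ray and make their
    interiors overlap. *)
Lemma cones_meet w A B (s t s' t' : R) : 0 < complex.Im w -> A != 0 -> B != 0 ->
  (forall c : R, 0 < c -> A <> c%:C * B) ->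
  (forall c : R, 0 < c -> A * (1 - w) <> c%:C * (B * w)) ->
  (forall s t s' t' : R, 0 < s -> 0 < t -> 0 < s' -> 0 < t' ->
    A * (s'%:C + t'%:C * (1 - w)) <> B * (s%:C + t%:C * w)) ->
  0 <= s -> 0 <= t -> 0 <= s' -> 0 <= t' ->
  A * (s'%:C + t'%:C * (1 - w)) = B * (s%:C + t%:C * w) ->
  [/\ s = 0, t = 0, s' = 0 & t' = 0].
Proof.
move=> w0 A0 B0 hi hii hiii s0 t0 s'0 t'0.
have -> : A = (A / B) * B by rewrite divfK.
have {A0} k0 : A / B != 0 by rewrite mulf_neq0 ?invr_eq0.
have {}hi : forall c : R, 0 < c -> A / B <> c%:C.
  by move=> c c0 e; apply: (hi c) => //; rewrite -e divfK.
have {}hii : forall c : R, 0 < c -> A / B * (1 - w) <> c%:C * w.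
  by move=> c c0 e; apply: (hii c) => //; rewrite [B * w]mulrC mulrA -e mulrAC divfK.
have {}hiii : forall s t s' t' : R, 0 < s -> 0 < t -> 0 < s' -> 0 < t' ->
    A / B * (s'%:C + t'%:C * (1 - w)) <> s%:C + t%:C * w.
  move=> {s0 t0 s'0 t'0} {}s {}t {}s' {}t' s0 t0 s'0 t'0 e.
  by apply: (hiii s t s' t') => //; rewrite -e mulrA [B * _]mulrC divfK.
rewrite -mulrA mulrCA => /(mulfI B0).
move: (A / B) k0 hi hii hiii => k.
case: w w0 => u v /= v0; case: k => x y.
have vn0 : v != 0 by rewrite gt_eqF.
have [r ->] : exists r, y = r * v by exists (y / v); rewrite divfK.
have [p ->] : exists p, x = p + r * u by exists (x - r * u); rewrite subrK.
move=> k0 hi hii hiii.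
have n_gt : u ^+ 2 < u ^+ 2 + v ^+ 2 by rewrite ltrDl exprn_gt0.
have pr : p != 0 \/ r != 0.
  apply/orP; rewrite -negb_and; apply: contraNN k0 => /andP[/eqP-> /eqP->].
  by rewrite eq_complex /= !mul0r addr0 eqxx.
have coord (a b : R) : ((p + r * u) +i* (r * v)) * (a%:C + b%:C * (1 - (u +i* v))) =
  (p * a + (p + r * (u ^+ 2 + v ^+ 2)) * b)%:C +
  (r * a + (r - p - 2 * u * r) * b)%:C * (u +i* v).
  by apply/eqP; rewrite eq_complex /=; apply/andP; split; apply/eqP; ring.
have uniq (a b c d : R) : a%:C + b%:C * (u +i* v) = c%:C + d%:C * (u +i* v) ->
    a = c /\ b = d.
  move/eqP; rewrite eq_complex /= !mul0r !subr0 !add0r !addr0.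
  move=> /andP[/eqP e1 /eqP /(mulIf vn0) e2]; split=> //.
  by move: e1; rewrite e2 => /addIr.
rewrite coord => /uniq[es et].
have [] := @cones_meet_coord p r (u ^+ 2 + v ^+ 2) u s' t' n_gt pr => //.
- move=> [r0 p0]; apply: (hi p) => //.
  by rewrite r0; apply/eqP; rewrite eq_complex /= !mul0r addr0 !eqxx.
- move=> [Q0 T0]; apply: (hii _ T0).
  have := coord 0 1; rewrite add0r mul1r => ->.
  by rewrite Q0 !mulr0 !mulr1 !add0r.
- move=> a b a0 b0 h1 h2; apply: (hiii _ _ _ _ h1 h2 a0 b0).
  by rewrite coord.
- by rewrite es.
- by rewrite et.
by move=> e1 e2; rewrite -es -et e1 e2 !mulr0 addr0.
Qed.
End Cones.

(** * A lower bound for the modulus on a finitely generated pointed cone *)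

Section PointedCones.
Context {R : realType}.

Lemma continuous_linear_form n (a : 'I_n -> R) :
  continuous (fun x : 'rV[R]_n => \sum_i x ord0 i * a i : R).
Proof.
elim: (index_enum _) => [|j r IH] x.
  by under eq_fun do rewrite big_nil; exact: cst_continuous.
under eq_fun do rewrite big_cons.
apply: (@continuousD _ _ _ (fun x => _) (fun x => _)); last exact: IH.
by apply: continuousM; [exact: coord_continuous|exact: cst_continuous].
Qed.

(** By compactness, the squared modulus attains its minimum on the standard simplex, and pointedness
    makes that minimum positive. Homogeneity extends the bound to all nonnegative coefficients. *)
Lemma pointed_cone_cmod n (v : 'I_n -> R[i]) :
  (forall x : 'I_n -> R, (forall i, 0 <= x i) ->
     \sum_i (x i)%:C * v i = 0 -> forall i, x i = 0) ->
  exists2 c : R, 0 < c & forall x : 'I_n -> R, (forall i, 0 <= x i) ->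
    c * (\sum_i x i) <= cmod (\sum_i (x i)%:C * v i).
Proof.
move=> hv.
pose re := fun x : 'rV[R]_n => \sum_i x ord0 i * complex.Re (v i).
pose im := fun x : 'rV[R]_n => \sum_i x ord0 i * complex.Im (v i).
have ReE (x : 'rV[R]_n) : complex.Re (\sum_i (x ord0 i)%:C * v i) = re x.
  rewrite (big_morph (@complex.Re R) (op1 := +%R) (id1 := 0)) //; last by case=> ? ? [].
  by apply: eq_bigr => i _; case: (v i) => ? ? /=; rewrite mul0r subr0.
have ImE (x : 'rV[R]_n) : complex.Im (\sum_i (x ord0 i)%:C * v i) = im x.
  rewrite (big_morph (@complex.Im R) (op1 := +%R) (id1 := 0)) //; last by case=> ? ? [].
  by apply: eq_bigr => i _; case: (v i) => ? ? /=; rewrite mul0r addr0.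
pose f (x : 'rV[R]_n) := re x ^+ 2 + im x ^+ 2.
have fE (x : 'rV[R]_n) : cmod (\sum_i (x ord0 i)%:C * v i) = Num.sqrt (f x).
  by rewrite cmodE ReE ImE.
(* The standard simplex; the factor 1 in the sum gives it the shape of [continuous_linear_form]. *)
pose K := [set x : 'rV[R]_n | forall i, `[0, 1]%classic (x ord0 i)] `&`
          [set x | \sum_i x ord0 i * 1 = 1].
have cK : compact K.
  apply: compact_closedI; first by
    apply: (@rV_compact R n (fun=> `[0, 1]%classic)) => i; exact: segment_compact.
  have /continuous_closedP := @continuous_linear_form n (fun=> 1).
  by move=> /(_ [set 1]); apply; exact: closed_eq.
have cf : {within K, continuous f}.
  apply: continuous_subspaceT => x; rewrite /f.
  by apply: (@continuousD _ _ _ (fun x => re x ^+ 2) (fun x => im x ^+ 2));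
    apply: continuousM; exact: continuous_linear_form.
have norm1 (x : 'I_n -> R) : (forall i, 0 <= x i) -> \sum_i x i = 1 -> K (\row_i x i).
  move=> x0 x1; split=> /=; last first.
    by rewrite -[RHS]x1; apply: eq_bigr => i _; rewrite mxE mulr1.
  move=> i; rewrite mxE in_itv /= x0 /= -x1 (bigD1 i) //= lerDl.
  by apply: sumr_ge0.
have sum0 (x : 'I_n -> R) : (forall i, 0 <= x i) -> ~~ (0 < \sum_i x i) -> \sum_i x i = 0.
  by move=> x0; rewrite lt_def sumr_ge0 // andbT negbK => /eqP.
(* The simplex can be empty, namely for n = 0. Then all coefficient sums vanish, as a positive one
   could be normalised into a point of the simplex, and any constant works. *)
have [[a Ka]|K0] := pselect (K !=set0); last first.
  exists 1 => // x x0; rewrite mul1r.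
  have [s0|/(sum0 _ x0) ->] := boolP (0 < \sum_i x i); last exact: cmod_ge0.
  case: K0; exists (\row_i (x i / \sum_i x i)); apply: norm1.
    by move=> i; rewrite divr_ge0 // ltW.
  by rewrite -mulr_suml divff // gt_eqF.
have [y yK ymin] := compact_EVT_min (ex_intro _ a Ka) cK cf.
have {yK} [y01 y1] : K y by rewrite inE in yK.
have f0 : 0 < f y.
  have fy : 0 <= f y by rewrite addr_ge0 ?sqr_ge0.
  rewrite lt_def fy andbT; apply/eqP => fy0.
  have := fE y; rewrite fy0 sqrtr0 => /eqP; rewrite cmod_eq0 => /eqP e.
  have y0 := hv (y ord0) _ e.
  move: y1 => /=; rewrite big1 => [/eqP|i _]; first by rewrite eq_sym oner_eq0.
  by rewrite mulr1 y0 // => j; have := y01 j; rewrite /= in_itv /= => /andP[].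
exists (Num.sqrt (f y)); first by rewrite sqrtr_gt0.
move=> x x0; have [s0|/(sum0 _ x0) ->] := boolP (0 < \sum_i x i); last first.
  by rewrite mulr0 cmod_ge0.
set s := \sum_i x i in s0 *.
pose x' i := x i / s.
have /ymin : (\row_i x' i : 'rV[R]_n) \in K.
  rewrite inE; apply: norm1 => [i|]; first by rewrite divr_ge0 // ltW.
  by rewrite -mulr_suml divff // gt_eqF.
move=> /ler_wsqrtr; rewrite -(fE (\row_i x' i)) => h.
have -> : \sum_i (x i)%:C * v i = s%:C * \sum_i (x' i)%:C * v i.
  rewrite mulr_sumr; apply: eq_bigr => i _.
  by rewrite mulrA -rmorphM /= [s * _]mulrC divfK // gt_eqF.
rewrite cmodM cmod_real gtr0_norm // mulrC ler_pM2l //.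
apply: (le_trans h); rewrite (eq_bigr (fun i => (x' i)%:C * v i)) // => i _.
by rewrite mxE.
Qed.
End PointedCones.

(** * Quantitative separation of two cones with a common apex *)

Section ConesApart.
Context {R : realType}.
Implicit Types (w A B : R[i]).

(** The differences of points of the two cones form the cone generated by [A], [A * (1 - w)], [- B]
    and [- (B * w)]. By [cones_meet] it is pointed, so [pointed_cone_cmod] applies. *)
Lemma cones_apart w A B : 0 < complex.Im w -> A != 0 -> B != 0 ->
  (forall c : R, 0 < c -> A <> c%:C * B) ->
  (forall c : R, 0 < c -> A * (1 - w) <> c%:C * (B * w)) ->
  (forall s t s' t' : R, 0 < s -> 0 < t -> 0 < s' -> 0 < t' ->
    A * (s'%:C + t'%:C * (1 - w)) <> B * (s%:C + t%:C * w)) ->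
  exists2 c : R, 0 < c & forall s t s' t' : R,
    0 <= s -> 0 <= t -> 0 <= s' -> 0 <= t' ->
    c * (cmod (A * (s'%:C + t'%:C * (1 - w))) + cmod (B * (s%:C + t%:C * w)))
      <= cmod (A * (s'%:C + t'%:C * (1 - w)) - B * (s%:C + t%:C * w)).
Proof.
move=> w0 A0 B0 hi hii hiii.
pose C := A * (1 - w); pose D := B * w.
pose v (i : 'I_4) := [:: A; C; - B; - D]`_i.
have vE (x : 'I_4 -> R) : \sum_i (x i)%:C * v i =
    A * ((x 0)%:C + (x 1)%:C * (1 - w)) - B * ((x 2)%:C + (x 3)%:C * w).
  rewrite !big_ord_recl big_ord0 /v /= addr0.
  have -> : lift ord0 ord0 = 1 :> 'I_4 by apply: val_inj.
  have -> : lift ord0 (lift ord0 ord0) = 2 :> 'I_4 by apply: val_inj.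
  have -> : lift ord0 (lift ord0 (lift ord0 ord0)) = 3 :> 'I_4 by apply: val_inj.
  by rewrite /C /D; ring.
have [|c c0 hc] := @pointed_cone_cmod R 4 v.
  move=> x x0; rewrite vE => /subr0_eq /(cones_meet w0 A0 B0 hi hii hiii).
  case=> // e2 e3 e0 e1 i.
  case: i => -[|[|[|[|//]]]] ilt; [rewrite -[RHS]e0|rewrite -[RHS]e1|
    rewrite -[RHS]e2|rewrite -[RHS]e3]; congr x; exact: val_inj.
(* [M] bounds the modulus of every generator, so that |X| + |Y| is at most [M] times the sum of the
   four coefficients; the summand 1 makes it positive. *)
pose M := cmod A + cmod C + cmod B + cmod D + 1.
have [a0 b0 c'0 d0] : [/\ 0 <= cmod A, 0 <= cmod B, 0 <= cmod C & 0 <= cmod D].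
  by rewrite !cmod_ge0.
have M0 : 0 < M by rewrite ltr_wpDl ?addr_ge0.
exists (c / M) => [|s t s' t' s0 t0 s'0 t'0]; first by rewrite divr_gt0.
set X := A * _; set Y := B * (_ + _).
have hv := hc (fun i : 'I_4 => [:: s'; t'; s; t]`_i).
rewrite vE /= -/X -/Y in hv; rewrite !big_ord_recl big_ord0 /= addr0 in hv.
apply: le_trans (hv _); last by case=> -[|[|[|[|//]]]].
rewrite mulrAC ler_pdivrMr // -mulrA ler_wpM2l ?(ltW c0) //.
have hX : cmod X <= s' * cmod A + t' * cmod C.
  rewrite /X mulrDr mulrCA [A * s'%:C]mulrC (le_trans (cmodD _ _)) //.
  by rewrite -/C !cmodM !cmod_real !ger0_norm.
have hY : cmod Y <= s * cmod B + t * cmod D.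
  rewrite /Y mulrDr mulrCA [B * s%:C]mulrC (le_trans (cmodD _ _)) //.
  by rewrite -/D !cmodM !cmod_real !ger0_norm.
apply: le_trans (lerD hX hY) _.
have le x y : 0 <= x -> y <= M -> x * y <= x * M by move=> x0 yM; rewrite ler_wpM2l.
have -> : (s' + (t' + (s + t))) * M = s' * M + t' * M + (s * M + t * M) by ring.
by rewrite !lerD // le // /M; lra.
Qed.
End ConesApart.

(** * Affine coordinates in a positively oriented triangle *)

Section Triangle.
Context {R : realType} (a b c : R[i]).
Hypothesis ccw : 0 < complex.Im ((c - a) / (b - a)).

Let w := (c - a) / (b - a).

(** [tri_x] and [tri_y] are the coordinates in the affine frame with origin [a] and axes [b - a] and
    [c - a]. *)
Definition tri_x (x : R[i]) : R := complex.Re ((x - a) / (b - a))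
  - complex.Im ((x - a) / (b - a)) / complex.Im w * complex.Re w.
Definition tri_y (x : R[i]) : R := complex.Im ((x - a) / (b - a)) / complex.Im w.

Lemma ccw_base_neq0 : b - a != 0.
Proof. by apply/eqP => e; move: ccw; rewrite e invr0 mulr0 ltxx. Qed.

Lemma tri_coordE x : (x - a) / (b - a) = (tri_x x)%:C + (tri_y x)%:C * w.
Proof.
have w0 : complex.Im w != 0 by rewrite gt_eqF.
apply/eqP; rewrite eq_complex /tri_x /tri_y; move: (_ / _) => [x1 x2] /=.
case: w w0 => u v /= v0; rewrite !mul0r addr0 add0r subr0 divfK // eqxx andbT.
by apply/eqP; ring.
Qed.

Lemma tri_coord_uniq x (s t : R) :
  (x - a) / (b - a) = s%:C + t%:C * w -> tri_x x = s /\ tri_y x = t.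
Proof.
have w0 : complex.Im w != 0 by rewrite gt_eqF.
rewrite /tri_x /tri_y => ->; case: w w0 => u v /= v0.
by rewrite !mul0r addr0 add0r subr0 mulfK //; split=> //; ring.
Qed.

Lemma triangleP x :
  triangle a b c x <-> [/\ 0 <= tri_x x, 0 <= tri_y x & tri_x x + tri_y x <= 1].
Proof.
have b0 := ccw_base_neq0.
split=> [[r [s [t [r0 s0 t0 rst xE]]]]|[s0 t0 st]].
  have [-> ->] : tri_x x = s /\ tri_y x = t.
    apply: tri_coord_uniq; rewrite xE /w.
    apply: (mulIf b0); rewrite divfK // mulrDl -[t%:C * _ * _]mulrA divfK //.
    have -> : r = 1 - s - t by rewrite -rst; ring.
    by rewrite !rmorphB rmorph1; ring.
  by split=> //; lra.
exists (1 - tri_x x - tri_y x), (tri_x x), (tri_y x); split=> //; [lra|lra|].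
rewrite -[LHS](subrK a) -[x - a](divfK b0) tri_coordE mulrDl -[_ * w * _]mulrA divfK //.
by rewrite !rmorphB rmorph1; ring.
Qed.

(** This serves twice: it passes the inequalities of [triangleP] to limits, and it provides a ball
    inside the triangle around a point that satisfies them strictly. *)
Lemma tri_lipschitz : exists2 M : R, 0 < M & forall x y,
  `|tri_x x - tri_x y| <= M * cmod (x - y) /\
  `|tri_y x - tri_y y| <= M * cmod (x - y).
Proof.
pose m := cmod (b - a)^-1; pose k := (complex.Im w)^-1.
have m0 : 0 <= m by exact: cmod_ge0.
have k0 : 0 < k by rewrite invr_gt0.
exists (m * (1 + k + k * `|complex.Re w|) + 1) => [|x y].
  by rewrite ltr_wpDl // mulr_ge0 // !addr_ge0 ?mulr_ge0 // ltW.
have diff : (x - a) / (b - a) - (y - a) / (b - a) = (x - y) / (b - a).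
  by rewrite -mulrBl; congr (_ / _); ring.
pose d := (x - y) / (b - a).
have d_le : cmod d = m * cmod (x - y) by rewrite cmodM mulrC.
have yE : tri_y x - tri_y y = complex.Im d * k.
  by rewrite /tri_y -mulrBl /d -diff; congr (_ / _);
    case: ((x - a) / _); case: ((y - a) / _).
have xE : tri_x x - tri_x y = complex.Re d - complex.Im d * k * complex.Re w.
  rewrite -yE /tri_x /tri_y /d -diff.
  by case: ((x - a) / _); case: ((y - a) / _) => ? ? ? ? /=; ring.
have hy : `|complex.Im d * k| <= k * cmod d.
  by rewrite normrM (gtr0_norm k0) mulrC ler_wpM2l ?(ltW k0) // Im_le_cmod.
have hx : `|complex.Re d - complex.Im d * k * complex.Re w| <=
    cmod d + k * cmod d * `|complex.Re w|.
  rewrite (le_trans (ler_normB _ _)) // lerD ?Re_le_cmod //.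
  by rewrite [X in X <= _]normrM ler_wpM2r.
have q0 := cmod_ge0 (x - y).
have p1 : 0 <= m * cmod (x - y) by exact: mulr_ge0.
have p2 : 0 <= k * (m * cmod (x - y)) by rewrite mulr_ge0 // ltW.
have p3 := mulr_ge0 p2 (normr_ge0 (complex.Re w)).
rewrite xE yE; move: hx hy; rewrite d_le => hx hy.
have -> : (m * (1 + k + k * `|complex.Re w|) + 1) * cmod (x - y) =
  m * cmod (x - y) + k * (m * cmod (x - y)) +
  k * (m * cmod (x - y)) * `|complex.Re w| + cmod (x - y) by ring.
by split; [apply: le_trans hx _|apply: le_trans hy _]; lra.
Qed.

Lemma triangle_closed : closed (triangle a b c).
Proof.
move=> x xT; apply/triangleP.
have [M M0 hM] := tri_lipschitz.
have near e : 0 < e -> exists2 y, triangle a b c y & cmod (x - y) < e.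
  move=> e0; have [|y [yT yB]] := xT [set y | cmod (x - y) < e].
    by apply/nbhs_cmod; exists e.
  by exists y.
have near' e : 0 < e ->
    [/\ - e <= tri_x x, - e <= tri_y x & tri_x x + tri_y x <= 1 + e].
  move=> e0; have [|y /triangleP[s0 t0 st] xy] := near (e / (2 * M)).
    by rewrite divr_gt0 // mulr_gt0.
  have [] := hM x y; move: xy; rewrite ltr_pdivlMr ?mulr_gt0 // => xy.
  by rewrite !ler_norml => /andP[? ?] /andP[? ?]; split; lra.
have le0 (u : R) : (forall e : R, 0 < e -> - e <= u) -> 0 <= u.
  move=> h; apply/ler_addgt0Pl => e /h; lra.
split.
- by apply: le0 => e /near'[].
- by apply: le0 => e /near'[].
- by apply/ler_addgt0Pr => e /near'[].
Qed.

Lemma closure_triangle_interior : closure (triangle a b c)° `<=` triangle a b c.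
Proof.
by move=> x /(closure_subset (@interior_subset _ _)) /triangle_closed.
Qed.

Lemma triangle_interiorP x :
  0 < tri_x x -> 0 < tri_y x -> tri_x x + tri_y x < 1 -> (triangle a b c)° x.
Proof.
move=> s0 t0 st; have [M M0 hM] := tri_lipschitz.
(* The last slack is halved because both coordinates may grow at once. *)
pose e := Num.min (tri_x x) (Num.min (tri_y x) ((1 - tri_x x - tri_y x) / 2)).
have e0 : 0 < e by rewrite !lt_min s0 t0 divr_gt0 //; lra.
have /and3P[e1 e2 e3] : [&& e <= tri_x x, e <= tri_y x &
    e <= (1 - tri_x x - tri_y x) / 2].
  by rewrite !ge_min !lexx !orbT.
apply/nbhs_cmod; exists (e / M) => [|y]; first by rewrite divr_gt0.
rewrite ltr_pdivlMr // => xy; apply/triangleP; have [] := hM x y.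
by rewrite !ler_norml => /andP[? ?] /andP[? ?]; split; lra.
Qed.

End Triangle.

(** * Locating the self-similar set inside a closed invariant set *)

Section Attractor.
Context {R : realType}.

Lemma compact_cmod_bounded (L : set R[i]) : compact L ->
  exists2 D : R, 0 < D & forall x, L x -> cmod x <= D.
Proof.
move=> cL; have [L0|nL0] := pselect (L !=set0); last first.
  by exists 1 => // x Lx; case: nL0; exists x.
have [|m _ mmax] := compact_EVT_max L0 cL (f := fun x => cmod x : R).
  exact: continuous_subspaceT cmod_continuous.
exists (cmod m + 1) => [|x Lx]; first by rewrite ltr_wpDl ?cmod_ge0.
by rewrite (le_trans (mmax x _)) ?lerDl // inE.
Qed.

(* Iterating x = S j x' brings points of L within r ^ n of the invariant set. *)
Lemma attractor_sub_invariant (J : finType) (S : J -> R[i] -> R[i]) (r : J -> R)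
    (T L : set R[i]) :
  (forall j, 0 <= r j < 1) ->
  (forall j x y, cmod (S j x - S j y) = r j * cmod (x - y)) ->
  closed T -> T !=set0 -> (forall j x, T x -> T (S j x)) ->
  compact L -> (forall x, L x -> exists j x', L x' /\ x = S j x') -> L `<=` T.
Proof.
move=> r01 Sr clT [b Tb] ST cL LS x Lx; apply: clT => U /nbhs_cmod[e e0 eU].
(* The largest ratio; the default 0 keeps it in [0, 1) even for an empty index type. *)
pose q := \big[Num.max/0]_j r j.
have q0 : 0 <= q by rewrite bigmax_ge_id.
have q1 : q < 1 by apply: bigmax_lt => // j _; case/andP: (r01 j).
have rq j : r j <= q by exact: le_bigmax.
have [D D0 hD] := compact_cmod_bounded cL.
have D'0 : 0 < D + cmod b by rewrite ltr_pwDl ?cmod_ge0.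
have near n : forall x, L x ->
    exists2 y, T y & cmod (x - y) <= q ^+ n * (D + cmod b).
  elim: n => [|n IH] {Lx eU} {}x Lx.
    exists b => //; rewrite mul1r (le_trans (cmodD _ _)) // cmodN lerD2r.
    exact: hD.
  have [j [x' [/IH[y Ty xy] ->]]] := LS _ Lx; exists (S j y); first exact: ST.
  rewrite Sr exprS -mulrA ler_pM ?cmod_ge0 //.
  by case/andP: (r01 j).
have [n] : exists n, q ^+ n < e / (D + cmod b).
  have := @cvg_expr R q; rewrite ger0_norm // => /(_ q1) /cvgrPdist_lt.
  move=> /(_ (e / (D + cmod b))); rewrite divr_gt0 // => /(_ isT) [n _ hn].
  exists n; have := hn n (leqnn n); rewrite /= sub0r normrN ger0_norm //.
  exact: exprn_ge0.
rewrite ltr_pdivlMr // => qn; have [y Ty xy] := near n x Lx.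
by exists y; split=> //; apply: eU; exact: le_lt_trans xy qn.
Qed.
End Attractor.

(** * Parametrisations of an arc and its order *)

Section Arc.
Context {R : realType}.
Implicit Types (g F : R -> R[i]) (A : set R[i]).

Lemma homeomorphism_inj g A : homeomorphism_unit_interval g A ->
  {in `[0, 1] &, injective g}.
Proof.
move=> [_ _ [h _ hK]] s t; rewrite !in_itv /= => s01 t01 e.
by rewrite -(hK s) // e hK.
Qed.

Lemma homeomorphism_mem g A s : homeomorphism_unit_interval g A ->
  0 <= s <= 1 -> A (g s).
Proof. by move=> [_ <- _] s01; exists s => //=; rewrite in_itv. Qed.

(** Take H = h o F, with h the continuous inverse of [g]. It is continuous and injective on [0, 1],
    hence strictly increasing since a <= b, and the intermediate value theorem makes it reach all of
    [a, b]. *)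
Lemma arc_reparam g A F (a b : R) : homeomorphism_unit_interval g A ->
  {within `[0, 1], continuous F} -> {in `[0, 1] &, injective F} ->
  (forall s, 0 <= s <= 1 -> A (F s)) ->
  0 <= a <= 1 -> 0 <= b <= 1 -> a <= b -> F 0 = g a -> F 1 = g b ->
  exists H : R -> R, [/\ forall s, 0 <= s <= 1 -> 0 <= H s <= 1 /\ g (H s) = F s,
    {in `[0, 1] &, {mono H : s t / s <= t}}, H 0 = a, H 1 = b
    & forall u, a <= u <= b -> exists2 s, 0 <= s <= 1 & H s = u].
Proof.
move=> hg cF iF FA a01 b01 ab F0 F1; have [_ gA [h ch hK]] := hg.
pose H s := h (F s).
have HP s : 0 <= s <= 1 -> 0 <= H s <= 1 /\ g (H s) = F s.
  move=> /FA; rewrite -gA => -[u]; rewrite /= in_itv /= => u01.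
  by rewrite /H => <-; rewrite hK.
have H0 : H 0 = a by rewrite /H F0 hK.
have H1 : H 1 = b by rewrite /H F1 hK.
have cH : {within `[0, 1], continuous H}.
  apply/subspace_continuousP => s s01 U; rewrite /H => hU.
  have As : A (F s) by apply: FA; move: s01; rewrite /= in_itv.
  have /subspace_continuousP/(_ _ As _ hU) := ch.
  move/subspace_continuousP/(_ _ s01): cF => /(_ _) /[apply].
  rewrite /= /nbhs /= /within /=; apply: filterS => t hh t01.
  by apply: hh => //; apply: FA; rewrite in_itv in t01.
have iH : {in `[0, 1] &, injective H}.
  move=> s t s01 t01 e; apply: iF => //.
  rewrite !in_itv /= in s01 t01.
  by have [_ <-] := HP _ s01; have [_ <-] := HP _ t01; rewrite e.
exists H; split=> //.
- by apply: segment_continuous_inj_le => //; rewrite H0 H1.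
- move=> u uab; have [|s] := @IVT R H 0 1 u ler01 cH; last by exists s.
    by rewrite H0 H1 (min_idPl ab) (max_idPr ab).
Qed.

(** [arc_le] leaves the parametrisation open. Two of them with the same ends differ by an increasing
    change of parameter, so a fixed [g] decides the order. *)
Lemma arc_leP g A x y : homeomorphism_unit_interval g A ->
  arc_le A (g 0) (g 1) x y <->
  exists s t, [/\ 0 <= s, s <= t, t <= 1, g s = x & g t = y].
Proof.
move=> hg; split=> [[f [hf f0 f1 [s [t [s0 st t1 <- <-]]]]]|st]; last by exists g.
have [cf _ _] := hf.
have [||||H [HP mH _ _ _]] := arc_reparam hg cf (homeomorphism_inj hf) _ _ _ _ f0 f1.
- by move=> u; exact: (homeomorphism_mem hf).
- by rewrite lexx ler01.
- by rewrite lexx ler01.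
- exact: ler01.
have s01 : 0 <= s <= 1 by rewrite s0 (le_trans st).
have t01 : 0 <= t <= 1 by rewrite t1 (le_trans s0).
have [/andP[Hs0 _] gs] := HP _ s01; have [/andP[_ Ht1] gt] := HP _ t01.
by exists (H s), (H t); split=> //; rewrite mH ?in_itv.
Qed.

Lemma arc_le_param g A s t : homeomorphism_unit_interval g A ->
  0 <= s <= 1 -> 0 <= t <= 1 -> arc_le A (g 0) (g 1) (g s) (g t) -> s <= t.
Proof.
move=> hg s01 t01 /(arc_leP _ _ hg)[s' [t' [s'0 st t'1 es et]]].
have inj := homeomorphism_inj hg.
have s'01 : 0 <= s' <= 1 by rewrite s'0 (le_trans st).
have t'01 : 0 <= t' <= 1 by rewrite t'1 (le_trans s'0).
have <- : s' = s by apply: inj; rewrite ?in_itv.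
by have <- : t' = t by apply: inj; rewrite ?in_itv.
Qed.

(** Reversal exchanges the ends, so that an estimate at the end of parameter 1 also serves the other
    end. *)
Lemma homeomorphism_rev g A : homeomorphism_unit_interval g A ->
  homeomorphism_unit_interval (fun s => g (1 - s)) A.
Proof.
have rev01 (s : R) : 0 <= s <= 1 -> 0 <= 1 - s <= 1.
  by case/andP=> s0 s1; apply/andP; split; lra.
move=> [cg gA [h ch hK]]; split.
- apply/subspace_continuousP => s s01 U hU.
  have s01' : `[0, 1]%classic (1 - s) by move: s01; rewrite /= !in_itv; exact: rev01.
  move/subspace_continuousP/(_ _ s01' _ hU): cg => cgU.
  have c : continuous (fun t : R => 1 - t).
    by move=> t; apply: continuousB; [exact: cst_continuous|move=> V].
  suff : nbhs s [set t | `[0, 1]%classic t -> U (g (1 - t))] by [].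
  have := c s _ cgU; apply: (@filterS _ (nbhs s)) => t /= hh t01.
  by apply: hh; move: t01; rewrite !in_itv; exact: rev01.
- rewrite -gA; apply/seteqP; split=> x [s /=]; rewrite in_itv /= => s01 <-.
    by exists (1 - s) => //; rewrite /= in_itv; exact: rev01.
  by exists (1 - s); rewrite /= ?in_itv ?subKr //; exact: rev01.
exists (fun x => 1 - h x) => [|s s01]; last by rewrite hK ?subKr // rev01.
have := ch; rewrite /continuous_at => ch' x.
by apply: continuousB; [exact: cst_continuous|exact: ch'].
Qed.

End Arc.

(** * Similarities that map an arc into itself *)

Section SimilarArcs.
Context {R : realType}.
Variables (f : R[i] -> R[i]) (r : R).
Hypotheses (r_gt0 : 0 < r)
  (f_sim : forall x y, cmod (f x - f y) = r * cmod (x - y)).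

Lemma similarity_continuous : continuous f.
Proof.
move=> x U /nbhs_cmod[e e0 eU]; apply/nbhs_cmod; exists (e / r).
  by rewrite divr_gt0.
by move=> y; rewrite ltr_pdivlMr // mulrC -f_sim => /eU.
Qed.

Lemma similarity_inj : injective f.
Proof.
move=> x y e; apply/eqP; rewrite -subr_eq0 -cmod_eq0.
have /eqP : r * cmod (x - y) = 0 by rewrite -f_sim e subrr cmod0.
by rewrite mulf_eq0 gt_eqF.
Qed.

(** Applied to f o g, [arc_reparam] turns the similarity into an increasing map of parameters from
    [0, 1] onto [a, b]. *)
Lemma arc_similarity (g : R -> R[i]) A (a b : R) :
  homeomorphism_unit_interval g A -> (forall x, A x -> A (f x)) ->
  0 <= a <= 1 -> 0 <= b <= 1 -> a <= b -> f (g 0) = g a -> f (g 1) = g b ->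
  exists H : R -> R, [/\ forall s, 0 <= s <= 1 -> 0 <= H s <= 1 /\ g (H s) = f (g s),
    {in `[0, 1] &, {mono H : s t / s <= t}}, H 0 = a, H 1 = b
    & forall u, a <= u <= b -> exists2 s, 0 <= s <= 1 & H s = u].
Proof.
move=> hg fA a01 b01 ab fg0 fg1; have [cg _ _] := hg.
have cF : {within `[0, 1], continuous (f \o g)}.
  apply/subspace_continuousP => s s01; move/subspace_continuousP: cg => /(_ s s01) cg.
  exact: (cvg_comp _ _ cg (@similarity_continuous (g s))).
have iF : {in `[0, 1] &, injective (f \o g)}.
  by move=> s t s01 t01 /= /similarity_inj; exact: (homeomorphism_inj hg).
have FA s : 0 <= s <= 1 -> A ((f \o g) s).
  by move=> s01; apply: fA; exact: (homeomorphism_mem hg).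
exact: (arc_reparam hg cF iF FA a01 b01 ab fg0 fg1).
Qed.

(* The fundamental domain [A \ f A] stays away from the fixed end of A, and
   the estimate on it propagates to the whole arc along the iterates of f. *)
Lemma arc_end_ratio (g : R -> R[i]) A :
  homeomorphism_unit_interval g A -> compact A -> (forall x, A x -> A (f x)) ->
  r < 1 -> f (g 1) = g 1 ->
  exists2 K : R, 0 < K & forall s u, 0 <= s -> s <= u -> u <= 1 ->
    cmod (g u - g 1) <= K * cmod (g s - g 1).
Proof.
move=> hg cA fA r1 fg1; have [cg gA [h ch hK]] := hg.
have i0 : 0 <= (0 : R) <= 1 by rewrite lexx ler01.
have i1 : 0 <= (1 : R) <= 1 by rewrite lexx ler01.
have mem s := @homeomorphism_mem _ _ _ s hg.
have [a a01 fg0] : exists2 a, 0 <= a <= 1 & f (g 0) = g a.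
  have := fA _ (mem _ i0); rewrite -{1}gA => -[a]; rewrite /= in_itv => a01 <-.
  by exists a.
have [|H [HP mH H0 H1 Hs]] := arc_similarity hg fA a01 i1 _ fg0 fg1.
  by case/andP: a01.
have a1 : a < 1.
  case/andP: a01 => _; rewrite le_eqVlt => /predU1P[a1|//].
  have : H 1 <= H 0 by rewrite H0 H1 a1.
  by rewrite mH ?in_itv //= ler10.
(* The inverse h is continuous at [g 1], where its value 1 exceeds [a]. Points of the arc close to
   [g 1] therefore have parameters beyond [a]. *)
have [m m0 hm] : exists2 m : R, 0 < m &
    forall s, 0 <= s -> s <= a -> m <= cmod (g s - g 1).
  have /subspace_continuousP/(_ _ (mem _ i1)) hc := ch.
  have [|m m0 hm] := (nbhs_cmod _ _).1 (hc [set t | a < t] _).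
    by rewrite /from_subspace hK //; exact: lt_nbhsr.
  exists m => // s s0 sa; rewrite leNgt; apply/negP => gs.
  have s01 : 0 <= s <= 1 by rewrite s0 (le_trans sa) // ltW.
  have : a < h (g s) by apply: (hm (g s)); [rewrite cmodB|exact: mem].
  by rewrite hK // ltNge sa.
have [D D0 hD] := compact_cmod_bounded cA.
have hD2 s : 0 <= s <= 1 -> cmod (g s - g 1) <= 2 * D.
  move=> s01; rewrite (le_trans (cmodD _ _)) // cmodN.
  by have := hD _ (mem _ s01); have := hD _ (mem _ i1); lra.
(* On the parameters up to [a], [m] bounds the denominator from below, while 2 D bounds every
   distance from above. *)
exists (2 * D / m) => [|s u s0 su u1]; first by rewrite divr_gt0 ?mulr_gt0.
have [/eqP gs|gs] := boolP (cmod (g s - g 1) == 0).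
  have s1 : s = 1.
    apply: (homeomorphism_inj hg); rewrite ?in_itv /= ?s0 ?(le_trans su) //.
    by apply/eqP; rewrite -subr_eq0 -cmod_eq0 gs.
  have -> : u = 1 by apply/le_anti; rewrite u1 -{1}s1.
  by rewrite subrr cmod0 gs mulr0.
(* Induction on the number of layers cut out by the iterates of [f]. For s <= a the constants
   suffice; otherwise both points are images under [f] of points in the same order, and cancelling
   [r] lowers n by one. For n = 0 the assumed lower bound contradicts the bound 2 D. *)
have key n : forall s u, 0 <= s -> s <= u -> u <= 1 ->
    r ^+ n * (2 * D) < cmod (g s - g 1) ->
    cmod (g u - g 1) <= 2 * D / m * cmod (g s - g 1).
  elim: n => [|n IH] {gs}{}s {}u {}s0 {}su {}u1.
    by rewrite mul1r ltNge hD2 // s0 (le_trans su).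
  have [sa _|/ltW a_s hs] := leP s a.
    rewrite (le_trans (hD2 u _)) ?u1 ?(le_trans s0) // -mulrA ler_peMr //.
      by rewrite mulr_ge0 // ltW.
    by rewrite mulrC ler_pdivlMr // mul1r hm.
  have [|s' s'01 es] := Hs s; first by rewrite a_s (le_trans su).
  have [|u' u'01 eu] := Hs u; first by rewrite (le_trans a_s) //.
  have [_ gs] := HP _ s'01; have [_ gu] := HP _ u'01.
  rewrite -eu -es gs gu -{1 2}fg1 !f_sim mulrCA ler_pM2l //.
  case/andP: (s'01) => s'0 _; case/andP: (u'01) => _ u'1.
  apply: IH => //; first by rewrite -mH ?in_itv // es eu.
  move: hs; rewrite -es gs -{1}fg1 f_sim exprS -mulrA ltr_pM2l //.
have [n rn] : exists n, r ^+ n < cmod (g s - g 1) / (2 * D).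
  have := @cvg_expr R r; rewrite ger0_norm ?(ltW r_gt0) // => /(_ r1) /cvgrPdist_lt.
  move=> /(_ (cmod (g s - g 1) / (2 * D))).
  have gs0 : 0 < cmod (g s - g 1) by rewrite lt_def gs cmod_ge0.
  rewrite divr_gt0 ?mulr_gt0 // => /(_ isT) [n _ hn].
  exists n; have := hn n (leqnn n); rewrite /= sub0r normrN ger0_norm //.
  by rewrite exprn_ge0 // ltW.
by apply: (key n) => //; rewrite -ltr_pdivlMr // mulr_gt0.
Qed.

End SimilarArcs.

(** * The triangle, its images and the two sectors at a corner *)

Section Corner.
Context {R : realType}.

(** This is how a positive corner angle enters: it forbids the quotient that defines the angle from
    being a positive real. *)
Lemma arg_gt0_real (c : R) : 0 < c -> arg c%:C = 0.
Proof.
move=> c0; have [|/andP[t0 t2]] := @arg_spec R c%:C.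
  by rewrite eq_complex /= negb_and gt_eqF.
rewrite cmod_real gtr0_norm // => /eqP; rewrite eq_complex /= => /andP[/eqP e _].
have {e} cos1 : cos (arg c%:C) = 1 by apply: (mulfI (lt0r_neq0 c0)); rewrite -e mulr1.
move: t0; rewrite le_eqVlt => /predU1P[//|t0].
(* A nonzero argument would have its half in (0, pi), where the sine is positive. *)
have : sin (arg c%:C / 2) ^+ 2 = 0.
  have := cosD (arg c%:C / 2) (arg c%:C / 2).
  have -> : arg c%:C / 2 + arg c%:C / 2 = arg c%:C by field.
  by rewrite cos1; have := cos2Dsin2 (arg c%:C / 2); rewrite !expr2; lra.
have := @sin_gt0_pi R (arg c%:C / 2).
rewrite divr_gt0 //= ltr_pdivrMr // mulrC t2 => /(_ isT) s0 /eqP.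
by rewrite sqrf_eq0 gt_eqF.
Qed.

Context (l : nat) (z : nat -> R[i]) (q : nat).
Hypothesis bf : basic_figure l z q.

Let w := (z q - z 0) / (z l - z 0).
Let S j := similitude l z j.
Let T := triangle (z 0) (z l) (z q).

Lemma similitudeB j x y :
  S j x - S j y = (z j - z j.-1) / (z l - z 0) * (x - y).
Proof. by rewrite /S /similitude; ring. Qed.

Lemma base_neq0 : z l - z 0 != 0.
Proof. exact: ccw_base_neq0 (bf_orientation bf). Qed.

Lemma cmod_similitudeB j x y :
  cmod (S j x - S j y) = cmod ((z j - z j.-1) / (z l - z 0)) * cmod (x - y).
Proof. by rewrite similitudeB cmodM. Qed.

Lemma similitude_ratio j : (1 <= j <= l)%N ->
  0 < cmod ((z j - z j.-1) / (z l - z 0)) < 1.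
Proof.
move=> jl; have [nd _] := bf_polygon bf; have b0 := base_neq0.
rewrite cmod_gt0 mulf_neq0 ?invr_eq0 //=; last by rewrite subr_eq0 eq_sym nd.
have [k k1 /(_ (z l) (z 0))] := bf_contractive bf jl.
rewrite -/(S j) cmod_similitudeB ler_pM2r ?cmod_gt0 // => h.
exact: le_lt_trans h k1.
Qed.

Lemma triangle_convex r s t x y u : 0 <= r -> 0 <= s -> 0 <= t -> r + s + t = 1 ->
  T x -> T y -> T u -> T (r%:C * x + s%:C * y + t%:C * u).
Proof.
have ccw := bf_orientation bf; have b0 := base_neq0.
move=> r0 s0 t0 rst.
move=> /(triangleP ccw)[x1 x2 x3] /(triangleP ccw)[y1 y2 y3] /(triangleP ccw)[u1 u2 u3].
pose cx v := tri_x (z 0) (z l) (z q) v; pose cy v := tri_y (z 0) (z l) (z q) v.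
have [ex ey] : cx (r%:C * x + s%:C * y + t%:C * u) = r * cx x + s * cx y + t * cx u /\
    cy (r%:C * x + s%:C * y + t%:C * u) = r * cy x + s * cy y + t * cy u.
  apply: tri_coord_uniq => //.
  have -> : r%:C * x + s%:C * y + t%:C * u - z 0 =
      r%:C * (x - z 0) + s%:C * (y - z 0) + t%:C * (u - z 0).
    have -> : r = 1 - s - t by rewrite -rst; ring.
    by rewrite !rmorphB rmorph1; ring.
  rewrite 2!mulrDl -3!mulrA (tri_coordE ccw x) (tri_coordE ccw y) (tri_coordE ccw u).
  rewrite -/w -!/(cx _) -!/(cy _); move: (cx x) (cx y) (cx u) (cy x) (cy y) (cy u).
  by move=> *; rewrite !rmorphD !rmorphM /=; ring.
apply/(triangleP ccw); rewrite -/(cx _) -/(cy _) ex ey; split.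
- by rewrite !addr_ge0 // mulr_ge0.
- by rewrite !addr_ge0 // mulr_ge0.
have := ler_wpM2l r0 x3; have := ler_wpM2l s0 y3; have := ler_wpM2l t0 u3.
by rewrite -/(cx x) -/(cy x) -/(cx y) -/(cy y) -/(cx u) -/(cy u); lra.
Qed.

Lemma vertex_in_triangle j : (j <= l)%N -> T (z j).
Proof.
have ccw := bf_orientation bf; move=> /(bf_vertices bf)[[->|[s /andP[s0 s1] ->]]|].
- by exists 0, 0, 1; split=> //; rewrite ?rmorph0 ?rmorph1; ring.
- exists (1 - s), s, 0; split=> //; [lra|lra|].
  by rewrite rmorphB rmorph1 rmorph0; ring.
- exact: interior_subset.
Qed.

(** An affine map preserves barycentric coordinates. The corners of the triangle go to two vertices
    of the polygon and to S_j(z_q), all in the triangle, which is convex. *)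
Lemma similitude_triangle j x : (1 <= j <= l)%N -> T x -> T (S j x).
Proof.
move=> jl [r [s [t [r0 s0 t0 rst ->]]]].
have b0 := base_neq0; have z0l : z 0 != z l by rewrite eq_sym -subr_eq0.
have -> : S j (r%:C * z 0 + s%:C * z l + t%:C * z q) =
    r%:C * S j (z 0) + s%:C * S j (z l) + t%:C * S j (z q).
  have -> : r = 1 - s - t by rewrite -rst; ring.
  by rewrite /S /similitude !rmorphB rmorph1; ring.
case/andP: (jl) => j1 jl'; have [e0 el] := similitude_ends j z0l.
apply: triangle_convex => //.
- by rewrite /S e0; apply: vertex_in_triangle; rewrite (leq_trans (leq_pred _)).
- by rewrite /S el; exact: vertex_in_triangle.
- exact: closure_triangle_interior (bf_orientation bf) _ (bf_apex_image bf jl).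
Qed.

Lemma self_similar_triangle L : self_similar_set l z L -> L `<=` T.
Proof.
move=> [cL _ LE].
(* Ordinals start at 0 and pieces at 1, hence the shift to [j.+1]. *)
apply: (@attractor_sub_invariant R 'I_l (fun j => S j.+1)
  (fun j => cmod ((z j.+1 - z j) / (z l - z 0)))) => //.
- by move=> j; have /andP[/ltW -> ->] := @similitude_ratio j.+1 (ltn_ord j).
- by move=> j x y; rewrite cmod_similitudeB.
- exact: triangle_closed (bf_orientation bf).
- by exists (z 0); exact: vertex_in_triangle.
- by move=> j x; apply: similitude_triangle; rewrite ltn_ord.
move=> x; rewrite {1}LE => -[[//|j] /= jl [x' Lx' <-]].
by exists (Ordinal jl), x'.
Qed.

Variable p : nat.
Hypotheses (hp : (1 <= p <= l.-1)%N) (htheta : 0 < corner_angle l z q p).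

Let A := z p.-1 - z p.
Let B := z p.+1 - z p.

(** In the normalised coordinate u = (x - z_0) / (z_l - z_0), the two pieces seen from z_p are A (1
    - u) and B u. For x in the triangle, 1 - u lies in the cone of 1 and 1 - w, and u in the cone of
    1 and w, which is the setting of [cones_apart]. *)
Lemma corner_left x : S p x - z p = A * (1 - (x - z 0) / (z l - z 0)).
Proof.
have b0 := base_neq0.
by rewrite /S /similitude /A; field.
Qed.

Lemma corner_right x : S p.+1 x - z p = B * ((x - z 0) / (z l - z 0)).
Proof. by rewrite /S /similitude /B /=; ring. Qed.

Lemma corner_apart : exists2 c : R, 0 < c & forall x y, T x -> T y ->
  c * (cmod (S p x - z p) + cmod (S p.+1 y - z p)) <= cmod (S p x - S p.+1 y).
Proof.
have ccw := bf_orientation bf; have b0 := base_neq0.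
have [nd fold] := bf_polygon bf.
have l0 : (0 < l)%N by case: (l) hp => [|//]; case: (p) => [|?]; rewrite ?andbF.
have pl : (1 <= p <= l)%N.
  by case/andP: hp => -> h; rewrite (leq_trans h) // leq_pred.
have p1l : (1 <= p.+1 <= l)%N by case/andP: hp => _; rewrite -ltnS prednK.
have A0 : A != 0 by rewrite subr_eq0 nd.
have B0 : B != 0 by rewrite subr_eq0 eq_sym (nd p.+1).
have [|||c c0 hc] := @cones_apart R w A B ccw A0 B0.
(* On a common outer ray the shorter of the two segments lies in the other one: its far end, z_(p-1)
   if c <= 1 and z_(p+1) otherwise, would be a second common point. *)
- move=> c c0 AB.
  have sub (v : R[i]) : closed_segment (z p.-1) (z p) v ->
      closed_segment (z p) (z p.+1) v -> v = z p.
    by move=> v1 v2; have : [set z p] v by rewrite -(fold p hp); split.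
  have [c1|/ltW c1] := leP c 1.
    case/eqP: A0; rewrite /A (sub (z p.-1)) ?subrr //.
      by exists 0; rewrite ?lexx ?ler01 // mul0r addr0.
    by exists c; rewrite ?(ltW c0) ?c1 // -/B -AB /A; ring.
  case/eqP: B0; rewrite /B (sub (z p.+1)) ?subrr //.
    have cn0 : c%:C != 0 by rewrite eq_complex /= negb_and gt_eqF.
    exists (1 - c^-1).
      by rewrite subr_ge0 gerBl invr_ge0 (ltW c0) invf_le1 ?c1.
    have -> : z p.+1 = z p + c%:C^-1 * A by rewrite AB mulKf // /B; ring.
    by rewrite rmorphB rmorph1 fmorphV /A; ring.
  by exists 1; rewrite ?lexx ?ler01 // mul1r; ring.
(* The vectors [A * (1 - w)] and [B * w] point from z_p to S_p(z_q) and S_(p+1)(z_q). A positive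
   ratio would make the corner angle 0. *)
- move=> c c0 AB; have w0 : w != 0.
    by apply/eqP => e; move: ccw; rewrite -/w e ltxx.
  move: htheta; rewrite /corner_angle -/(S p) -/(S p.+1) corner_left corner_right -/w.
  have Bw0 : B * w != 0 by rewrite mulf_eq0 negb_or B0.
  by rewrite AB mulfK // arg_gt0_real // ltxx.
- move=> s t s' t' s0 t0 s'0 t'0 AB.
  (* Scaling by [d] brings a common point of the open cones so close to the apex that its preimages
     [pt zx] and [pt zy] are both in the open triangle, against the disjointness of the images. *)
  pose d := (1 + s + t + s' + t')^-1.
  have d0 : 0 < d by rewrite invr_gt0 !addr_gt0.
  have dE : d * (1 + s + t + s' + t') = 1 by rewrite mulVf // gt_eqF // !addr_gt0.
  pose zx := 1 - d%:C * (s'%:C + t'%:C * (1 - w)).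
  pose zy := d%:C * (s%:C + t%:C * w).
  pose pt u := z 0 + (z l - z 0) * u.
  have ptE u : (pt u - z 0) / (z l - z 0) = u.
    by rewrite /pt addrAC subrr add0r mulrAC divff ?mul1r.
  have ds := mulr_gt0 d0 s0; have dt := mulr_gt0 d0 t0.
  have ds' := mulr_gt0 d0 s'0; have dt' := mulr_gt0 d0 t'0.
  have Tx : (triangle (z 0) (z l) (z q))° (pt zx).
    have [ex ey] : tri_x (z 0) (z l) (z q) (pt zx) = 1 - d * s' - d * t' /\
        tri_y (z 0) (z l) (z q) (pt zx) = d * t'.
      by apply: tri_coord_uniq => //; rewrite ptE /zx !rmorphB !rmorphM rmorph1 -/w; ring.
    by apply: triangle_interiorP => //; rewrite ?ex ?ey //; lra.
  have Ty : (triangle (z 0) (z l) (z q))° (pt zy).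
    have [ex ey] : tri_x (z 0) (z l) (z q) (pt zy) = d * s /\
        tri_y (z 0) (z l) (z q) (pt zy) = d * t.
      by apply: tri_coord_uniq => //; rewrite ptE /zy !rmorphM -/w; ring.
    by apply: triangle_interiorP => //; rewrite ?ex ?ey //; lra.
  have e : S p (pt zx) = S p.+1 (pt zy).
    apply: (addIr (- z p)); rewrite corner_left corner_right !ptE /zx /zy.
    by rewrite subKr mulrCA AB mulrCA.
  have /eqP := bf_disjoint bf pl p1l (ex_intro _ (S p (pt zx))
    (conj (ex_intro2 _ _ _ Tx erefl) (ex_intro2 _ _ _ Ty (esym e)))).
  by rewrite ltn_eqF.
exists c => // x y /(triangleP ccw)[x1 x2 x3] /(triangleP ccw)[y1 y2 y3].
have -> : S p x - S p.+1 y = (S p x - z p) - (S p.+1 y - z p) by ring.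
rewrite corner_left corner_right (tri_coordE ccw x) (tri_coordE ccw y) -/w.
set X := tri_x _ _ _ x in x1 x3 *; set Y := tri_y _ _ _ x in x2 x3 *.
have -> : 1 - (X%:C + Y%:C * w) = (1 - X - Y)%:C + Y%:C * (1 - w).
  by rewrite !rmorphB rmorph1; ring.
by apply: hc => //; lra.
Qed.

End Corner.

(** * Diameters, powers, and the end estimates on the pieces of the arc *)

Section SelfSimilarArc.
Context {R : realType}.

Lemma diam_le (A : set R[i]) (M : R) : A !=set0 ->
  (forall x y, A x -> A y -> cmod (x - y) <= M) -> 0 <= diam A <= M.
Proof.
move=> [a Aa] hM; rewrite /diam; set D := [set _ | _].
have ubD : ubound D M by move=> d [x [y [Ax Ay ->]]]; exact: hM.
have D0 : D 0 by exists a, a; rewrite subrr cmod0.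
by rewrite ub_le_sup ?ge_sup //; [exists 0|exists M].
Qed.

(** Splitting off one factor of d^t and bounding the others by [N] reduces exponents t >= 1 to the
    linear estimate. *)
Lemma powR_le_linear (d N t : R) : 1 <= t -> 0 <= d -> d <= N -> 0 < N ->
  d `^ t <= N `^ (t - 1) * d.
Proof.
move=> t1 d0 dN N0; have [->|dn0] := eqVneq d 0.
  by rewrite mulr0 powR0 //; lra.
have -> : d `^ t = d `^ (t - 1) * d.
  rewrite -{3}(powRr1 d0) -powRD ?subrK //.
  by rewrite dn0 implybT.
by rewrite ler_wpM2r // ge0_ler_powR ?nnegrE ?subr_ge0 // ltW.
Qed.

Lemma self_similar_sub l (z : nat -> R[i]) L j x : self_similar_set l z L ->
  (1 <= j <= l)%N -> L x -> L (similitude l z j x).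
Proof. by move=> [_ _ {2}->] jl Lx; exists j => //; exists x. Qed.

(** S_l fixes z_l and S_1 fixes z_0. The estimate [arc_end_ratio] is applied to [g] with S_l and to
    the reversed arc with S_1; the sum of the two constants serves both ends. *)
Lemma self_similar_arc_end_ratios l z q L (g : R -> R[i]) : basic_figure l z q ->
  self_similar_set l z L -> homeomorphism_unit_interval g L ->
  g 0 = z 0 -> g 1 = z l -> (0 < l)%N ->
  exists2 K : R, 0 < K & forall s u, 0 <= s -> s <= u -> u <= 1 ->
    cmod (g u - z l) <= K * cmod (g s - z l) /\
    cmod (g s - z 0) <= K * cmod (g u - z 0).
Proof.
move=> bf ss hg g0 g1 l0; have b0 := base_neq0 bf; have [cL _ _] := ss.
have z0l : z 0 != z l by rewrite eq_sym -subr_eq0.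
have ll : (1 <= l <= l)%N by rewrite l0 leqnn.
have l1 : (1 <= 1 <= l)%N by [].
have /andP[rl0 rl1] := similitude_ratio bf ll.
have /andP[r10 r11] := similitude_ratio bf l1.
have fix_l : similitude l z l (g 1) = g 1.
  by rewrite g1; case: (similitude_ends l z0l).
have fix_0 : similitude l z 1 (g (1 - 1)) = g (1 - 1).
  by rewrite subrr g0; case: (similitude_ends 1 z0l).
have [K K0 hK] := arc_end_ratio rl0 (@cmod_similitudeB _ l z l) hg cL
  (fun x => self_similar_sub ss ll) rl1 fix_l.
have [K' K'0 hK'] := arc_end_ratio r10 (@cmod_similitudeB _ l z 1)
  (homeomorphism_rev hg) cL (fun x => self_similar_sub ss l1) r11 fix_0.
exists (K + K') => [|s u s0 su u1]; first by rewrite addr_gt0.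
split.
  have := hK s u s0 su u1; rewrite g1 => /le_trans; apply.
  by rewrite ler_wpM2r ?cmod_ge0 // lerDl ltW.
have := hK' (1 - u) (1 - s); rewrite !subKr subrr g0 => h.
apply: le_trans (h _ _ _) _; [lra|lra|lra|].
by rewrite ler_wpM2r ?cmod_ge0 // lerDr ltW.
Qed.

(** Pulling points of the subarc from z_(j-1) to z_j back by S_j, in the same order, lets the
    estimates at z_0 and z_l be used at the vertices. *)
Lemma self_similar_piece l z q L (g : R -> R[i]) j (a b : R) : basic_figure l z q ->
  self_similar_set l z L -> homeomorphism_unit_interval g L ->
  g 0 = z 0 -> g 1 = z l -> (1 <= j <= l)%N ->
  0 <= a <= 1 -> 0 <= b <= 1 -> a <= b -> g a = z j.-1 -> g b = z j ->
  forall s u, a <= s -> s <= u -> u <= b -> exists s' u',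
    [/\ 0 <= s', s' <= u' & u' <= 1] /\
    g s = similitude l z j (g s') /\ g u = similitude l z j (g u').
Proof.
move=> bf ss hg g0 g1 jl a01 b01 ab ga gb s u a_s su ub.
have z0l : z 0 != z l by rewrite eq_sym -subr_eq0 (base_neq0 bf).
have [e0 el] := similitude_ends j z0l; have /andP[r0 _] := similitude_ratio bf jl.
have [||H [HP mH _ _ Hs]] := arc_similarity (a := a) (b := b) r0
  (@cmod_similitudeB _ l z j) hg (fun x => self_similar_sub ss jl) a01 b01 ab.
- by rewrite g0 e0 ga.
- by rewrite g1 el gb.
have [|s' s'01 es] := Hs s; first by rewrite a_s (le_trans su).
have [|u' u'01 eu] := Hs u; first by rewrite ub (le_trans a_s).
exists s', u'; rewrite -{1}es -{1}eu.
have [_ ->] := HP _ s'01; have [_ ->] := HP _ u'01.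
case/andP: (s'01) => s'0 _; case/andP: (u'01) => _ u'1.
split; last by split.
by split=> //; rewrite -mH ?in_itv // es eu.
Qed.

End SelfSimilarArc.

(** * The diameter of a subarc through z_p against the distance of its ends *)

Theorem proposition6p2 (R : realType) (l q : nat) (z : nat -> R[i])
    (L : set R[i]) (hL : regular_self_similar_arc l z q L)
    (p : nat) (hp : (1 <= p <= l.-1)%N) (htheta : 0 < corner_angle l z q p)
    (t : R) (ht : 1 <= t) :
  condition_Q l z L p t.
Proof.
have [bf _ ss _] := hL; have [cL _ _] := ss.
(* Without a parametrisation from z_0 to z_l the relation [arc_le] never holds, and the condition is
   vacuous. *)
have [[g [hg g0 g1]]|ng] := pselect (exists g,
    [/\ homeomorphism_unit_interval g L, g 0 = z 0 & g 1 = z l]); last first.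
  by exists 1 => // x y _ _ [g [hg g0 g1 _]]; case: ng; exists g.
have l0 : (0 < l)%N by case: (l) hp => [|//]; case: (p) => [|?]; rewrite ?andbF.
have pl : (1 <= p <= l)%N.
  by case/andP: hp => -> h; rewrite (leq_trans h) // leq_pred.
have p1l : (1 <= p.+1 <= l)%N by case/andP: hp => _; rewrite -ltnS prednK.
have z0l : z 0 != z l by rewrite eq_sym -subr_eq0 (base_neq0 bf).
have [ep0 epl] := similitude_ends p z0l.
have [eq0 _] := similitude_ends p.+1 z0l.
have [K K0 hK] := self_similar_arc_end_ratios bf ss hg g0 g1 l0.
have [c c0 hc] := corner_apart bf hp htheta.
have [D D0 hD] := compact_cmod_bounded cL.
have LT := self_similar_triangle bf ss.
have mem s := @homeomorphism_mem _ _ _ s hg.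
(* The constant for t = 1: 2 passes from radius to diameter, [K] compares distances to z_p along one
   piece, and [c] separates the pieces. *)
pose C := 2 * K / c.
have C0 : 0 < C by rewrite divr_gt0 ?mulr_gt0.
have N0 : 0 < C * (2 * D) := mulr_gt0 C0 (mulr_gt0 (ltr0Sn _ 1) D0).
exists ((C * (2 * D)) `^ (t - 1) * C) => [|x y Lx Ly].
  by rewrite (mulr_gt0 (powR_gt0 _ N0)) ?C0.
rewrite /= -g0 -g1 => le0 le1 le2 le3.
have param u v : arc_le L (g 0) (g 1) u v -> exists2 s, 0 <= s <= 1 & g s = u.
  move=> /(arc_leP _ _ hg)[s1 [t1 [s10 st t11 <- _]]]; exists s1 => //.
  by rewrite s10 (le_trans st).
have param' u v : arc_le L (g 0) (g 1) u v -> exists2 s, 0 <= s <= 1 & g s = v.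
  move=> /(arc_leP _ _ hg)[s1 [t1 [s10 st t11 _ <-]]]; exists t1 => //.
  by rewrite t11 (le_trans s10).
have [a a01 ga] := param _ _ le0; have [s s01 gs] := param _ _ le1.
have [b b01 gb] := param _ _ le2; have [r r01 gr] := param' _ _ le2.
have [d d01 gd] := param' _ _ le3.
rewrite -ga -gs in le0; rewrite -gs -gb in le1; rewrite -gb -gr in le2.
rewrite -gr -gd in le3.
move: le0 le1 le2 le3 => /(arc_le_param hg a01 s01) a_s /(arc_le_param hg s01 b01) sb.
move=> /(arc_le_param hg b01 r01) br /(arc_le_param hg r01 d01) rd.
(* The radius of a disc about z_p that contains the subarc. The part before z_p uses z_p = S_p(z_l),
   the part after it z_p = S_(p+1)(z_0); the ratio of the similitude cancels. *)
pose M := K * (cmod (x - z p) + cmod (y - z p)).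
have leftM u : s <= u -> u <= b -> cmod (g u - z p) <= M.
  move=> su ub.
  have [s' [u' [[s'0 su' u'1] [es eu]]]] := self_similar_piece bf ss hg g0 g1 pl
    a01 b01 (le_trans a_s sb) ga gb a_s su ub.
  have [h _] := hK _ _ s'0 su' u'1.
  apply: le_trans (_ : _ <= K * cmod (x - z p)) _; last first.
    by rewrite /M mulrDr lerDl mulr_ge0 ?cmod_ge0 ?(ltW K0).
  rewrite -gs es eu -{1 2}epl !cmod_similitudeB mulrCA.
  by rewrite ler_wpM2l ?cmod_ge0.
have rightM u : b <= u -> u <= r -> cmod (g u - z p) <= M.
  move=> bu ur.
  have [u' [r' [[u'0 ur' r'1] [eu er]]]] := self_similar_piece bf ss hg g0 g1 p1l
    b01 d01 (le_trans br rd) gb gd bu ur rd.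
  have [_ h] := hK _ _ u'0 ur' r'1.
  apply: le_trans (_ : _ <= K * cmod (y - z p)) _; last first.
    by rewrite /M mulrDr lerDr mulr_ge0 ?cmod_ge0 ?(ltW K0).
  rewrite -gr er eu -{1 2}eq0 !cmod_similitudeB mulrCA.
  by rewrite ler_wpM2l ?cmod_ge0.
have betweenM v : subarc L (g 0) (g 1) x y v -> cmod (v - z p) <= M.
  rewrite -gs -gr.
  have ends u : s <= u <= r -> cmod (g u - z p) <= M.
    by case/andP=> su ur; have [ub|/ltW bu] := leP u b; [exact: leftM|exact: rightM].
  case=> -[h1 h2]; have [u u01 gu] := param' _ _ h1; rewrite -gu in h1 h2 *; apply: ends.
    by rewrite (arc_le_param hg s01 u01 h1) (arc_le_param hg u01 r01 h2).
  (* In the reversed alternative of [subarc], r <= u <= s together with s <= b <= r forces u = s =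
     r. *)
  have := arc_le_param hg r01 u01 h1; have := arc_le_param hg u01 s01 h2.
  by move=> *; apply/andP; split; lra.
have /andP[diam0 diamM] : 0 <= diam (subarc L (g 0) (g 1) x y) <= 2 * M.
  apply: diam_le => [|v v' /betweenM hv /betweenM hv'].
    exists x; left; rewrite -gs -gr; split; apply/(arc_leP _ _ hg).
      by exists s, s; case/andP: (s01) => ? ?.
    exists s, r; case/andP: (s01) => ? ?; case/andP: (r01) => ? ?.
    by split=> //; exact: le_trans sb br.
  have -> : v - v' = (v - z p) - (v' - z p) by ring.
  by rewrite (le_trans (cmodD _ _)) // cmodN; lra.
have MC : 2 * M <= C * cmod (x - y).
  have [x' [u' [[x'0 xu u'1] [ex _]]]] := self_similar_piece bf ss hg g0 g1 pl
    a01 b01 (le_trans a_s sb) ga gb a_s (lexx s) sb.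
  have [y' [v' [[y'0 yv v'1] [ey _]]]] := self_similar_piece bf ss hg g0 g1 p1l
    b01 d01 (le_trans br rd) gb gd br (lexx r) rd.
  have Tx : triangle (z 0) (z l) (z q) (g x') by apply/LT/mem; rewrite x'0 (le_trans xu).
  have Ty : triangle (z 0) (z l) (z q) (g y') by apply/LT/mem; rewrite y'0 (le_trans yv).
  have := hc _ _ Tx Ty; rewrite -ex -ey gs gr mulrC -ler_pdivlMr // => h.
  have -> : C * cmod (x - y) = 2 * (K * (cmod (x - y) / c)) by rewrite /C; ring.
  by rewrite /M !ler_pM2l.
have xy2 : cmod (x - y) <= 2 * D.
  by rewrite (le_trans (cmodD _ _)) // cmodN; have := hD _ Lx; have := hD _ Ly; lra.
have dC := le_trans diamM MC.
(* All distances in [L] are at most 2 D, so C (2 D) bounds the diameter and can play the role of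
   N. *)
apply: le_trans (powR_le_linear ht diam0 (le_trans dC _) N0) _.
  by rewrite ler_wpM2l ?(ltW C0).
by rewrite -mulrA ler_wpM2l ?powR_ge0.
Qed.
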